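(* Let $K$ be a number field and let $y_1,y_2,y_3$ be distinct algebraic numbers such that the elliptic curve $E:z^2=(y-y_1)(y-y_2)(y-y_3)$ satisfies $j(E)\neq0,1728$. Then there exists a quartic polynomial $f\in K[x]$ with $C_f=\{y_1,y_2,y_3\}$ if and only if $E$ is defined over $K$ (i.e. $(y-y_1)(y-y_2)(y-y_3)\in K[y]$) and $j(E)=\frac{(u+3)^3(u+27)}{u}$ for some $u\in K^*$.
   Context: For a polynomial $f$ over $\overline{\mathbb{Q}}$, $C_f$ denotes its multiset of finite critical values, i.e. the values $f(z)$ for $z$ running over the roots of $f'$ counted with multiplicity. $j(E)$ is the usual $j$-invariant of the elliptic curve $E$. *)

(* Defs.v *)
From HB Require Import structures.
From mathcomp Require Import all_boot all_order all_algebra all_field.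

Set Implicit Arguments.
Unset Strict Implicit.
Unset Printing Implicit Defensive.

Import GRing.Theory.
Local Open Scope ring_scope.

(* Roots listed with multiplicity, so that
   p = lead_coef p *: \prod_(z <- roots_mult p) ('X - z%:P).
   Meaningful only for p != 0. *)
Definition roots_mult (p : {poly algC}) : seq algC :=
  sval (closed_field_poly_normal p).

(* The multiset C_f is encoded as a sequence, to be compared up to perm_eq. *)
Definition critical_values (f : {poly algC}) : seq algC :=
  [seq f.[z] | z <- roots_mult f^`()].

(* y^2 + a1 x y + a3 y = x^3 + a2 x^2 + a4 x + a6 *)
Record weierstrass (F : fieldType) :=
  Weierstrass { a1 : F; a2 : F; a3 : F; a4 : F; a6 : F }.

Section Invariants.
Variables (F : fieldType) (E : weierstrass F).

Definition b2 : F := a1 E ^+ 2 + 4 * a2 E.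
Definition b4 : F := 2 * a4 E + a1 E * a3 E.
Definition b6 : F := a3 E ^+ 2 + 4 * a6 E.
Definition b8 : F :=
  a1 E ^+ 2 * a6 E + 4 * a2 E * a6 E - a1 E * a3 E * a4 E
  + a2 E * a3 E ^+ 2 - a4 E ^+ 2.
Definition c4 : F := b2 ^+ 2 - 24 * b4.
Definition discriminant : F :=
  - (b2 ^+ 2 * b8) - 8 * b4 ^+ 3 - 27 * b6 ^+ 2 + 9 * b2 * b4 * b6.
(* The usual j-invariant when E is smooth, i.e. when discriminant != 0. *)
Definition j_invariant : F := c4 ^+ 3 / discriminant.

End Invariants.

(* The curve z^2 = p(y), for p a monic cubic. *)
Definition cubic_curve (F : fieldType) (p : {poly F}) : weierstrass F :=
  Weierstrass 0 p`_2 0 p`_1 p`_0.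

(* p has coefficients in K, viewed inside algC through iota. *)
Definition defined_over (K : fieldExtType rat) (iota : {rmorphism K -> algC})
    (p : {poly algC}) : Prop :=
  exists q : {poly K}, map_poly iota q = p.

Definition cubic_of_roots (y1 y2 y3 : algC) : {poly algC} :=
  ('X - y1%:P) * ('X - y2%:P) * ('X - y3%:P).

(* Main.v *)
Require Import Defs.
From HB Require Import structures.
From mathcomp Require Import all_boot all_order all_algebra all_field.
From mathcomp Require Import ring.
Import GRing.Theory Num.Theory.
Local Open Scope ring_scope.

(* Write the quartic as a(x'^4 + p x'^2 + q x') + d with x' = x - m.  The curve
   attached to its critical values has c4 and c6 homogeneous in (a, p, q), and
   its j-invariant is -4096 s (s - 27)^3 / (8 s + 27)^3 for s = p^3 / q^2; the
   change of variable u = -729 / (8 s + 27) turns this into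
   (u + 3)^3 (u + 27) / u.  Conversely u determines s, and p = q = s realizes it;
   equality of j-invariants away from 0 and 1728 makes the two curves quadratic
   twists over K, and the twisting factor and the translation are absorbed by
   a and d. *)

(** * The invariants of a monic cubic and of its curve *)

Definition c6 {F : fieldType} (E : weierstrass F) : F :=
  - b2 E ^+ 3 + 36 * b2 E * b4 E - 216 * b6 E.

Lemma discriminant_c4_c6 (F : fieldType) (E : weierstrass F) :
  1728 * discriminant E = c4 E ^+ 3 - c6 E ^+ 2.
Proof.
by rewrite /discriminant /c4 /c6 /b8 /b2 /b4 /b6; ring.
Qed.

Lemma j_invariant_eq1728 (F : fieldType) (E : weierstrass F) :
  discriminant E != 0 -> c6 E = 0 -> j_invariant E = 1728.
Proof.
move=> D0 C0; have := discriminant_c4_c6 _ E.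
by rewrite C0 expr0n subr0 /j_invariant => <-; rewrite mulfK.
Qed.

(* The monic cubic with given a2, c4, c6; solves c4 = 16 a2^2 - 48 a4 and
   c6 = - 64 a2^3 + 288 a2 a4 - 864 a6. *)
Definition cubic_of_invariants {F : fieldType} (A C D : F) : {poly F} :=
  let B := (16 * A ^+ 2 - C) / 48 in
  'X^3 + A%:P * 'X^2 + B%:P * 'X + ((- 64 * A ^+ 3 + 288 * A * B - D) / 864)%:P.

Lemma map_cubic_of_invariants (F G : fieldType) (h : {rmorphism F -> G}) A C D :
  map_poly h (cubic_of_invariants A C D) =
  cubic_of_invariants (h A) (h C) (h D).
Proof.
have mapE a b c : map_poly h ('X^3 + a%:P * 'X^2 + b%:P * 'X + c%:P) =
    'X^3 + (h a)%:P * 'X^2 + (h b)%:P * 'X + (h c)%:P.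
  by rewrite 3!rmorphD 2!rmorphM /= !map_polyC !map_polyXn map_polyX.
have mapB : h ((16 * A ^+ 2 - C) / 48) = (16 * h A ^+ 2 - h C) / 48.
  by rewrite fmorph_div rmorph_nat; congr (_ / _); ring.
rewrite /cubic_of_invariants mapE mapB; congr (_ + _%:P).
by rewrite -mapB fmorph_div rmorph_nat; congr (_ / _); ring.
Qed.

Lemma c4_map (F G : fieldType) (h : {rmorphism F -> G}) (p : {poly F}) :
  c4 (cubic_curve (map_poly h p)) = h (c4 (cubic_curve p)).
Proof. by rewrite /c4 /b2 /b4 /= !coef_map /=; ring. Qed.

Lemma c6_map (F G : fieldType) (h : {rmorphism F -> G}) (p : {poly F}) :
  c6 (cubic_curve (map_poly h p)) = h (c6 (cubic_curve p)).
Proof. by rewrite /c6 /b2 /b4 /b6 /= !coef_map /=; ring. Qed.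

Lemma cubic_of_roots_coefs (y1 y2 y3 : algC) :
  cubic_of_roots y1 y2 y3 =
  'X^3 + (- (y1 + y2 + y3))%:P * 'X^2
    + (y1 * y2 + y1 * y3 + y2 * y3)%:P * 'X + (- (y1 * y2 * y3))%:P.
Proof. rewrite /cubic_of_roots; ring. Qed.

Lemma cubic_curve_of_roots (y1 y2 y3 : algC) :
  cubic_curve (cubic_of_roots y1 y2 y3) =
  Weierstrass 0 (- (y1 + y2 + y3)) 0 (y1 * y2 + y1 * y3 + y2 * y3)
    (- (y1 * y2 * y3)).
Proof.
rewrite cubic_of_roots_coefs /cubic_curve.
congr Weierstrass; rewrite !coefE /=; ring.
Qed.

(** The triple [a2], [c4], [c6] determines the cubic, so two cubics can be compared, or descended to
    [K], through these three numbers. *)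
Lemma cubic_of_rootsE (y1 y2 y3 : algC) :
  let E := cubic_curve (cubic_of_roots y1 y2 y3) in
  cubic_of_roots y1 y2 y3 = cubic_of_invariants (a2 E) (c4 E) (c6 E).
Proof.
rewrite cubic_curve_of_roots cubic_of_roots_coefs.
rewrite /cubic_of_invariants /c4 /c6 /b2 /b4 /b6.
by congr (_ + _%:P * _ + _%:P) => /=; field.
Qed.

Lemma discriminant_of_roots (y1 y2 y3 : algC) :
  discriminant (cubic_curve (cubic_of_roots y1 y2 y3)) =
  16 * ((y1 - y2) * (y1 - y3) * (y2 - y3)) ^+ 2.
Proof.
rewrite cubic_curve_of_roots /discriminant /b8 /b2 /b4 /b6 /=; ring.
Qed.

Lemma discriminant_neq0 (y1 y2 y3 : algC) :
  uniq [:: y1; y2; y3] ->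
  discriminant (cubic_curve (cubic_of_roots y1 y2 y3)) != 0.
Proof.
rewrite discriminant_of_roots /= !inE negb_or andbT.
move=> /andP[/andP[h12 h13] h23].
by rewrite mulf_neq0 ?pnatr_eq0 // sqrf_eq0 !mulf_neq0 // subr_eq0.
Qed.

(** * Centered quartics and their critical values *)

Definition centered_quartic {F : fieldType} (a m p q d : F) : {poly F} :=
  a%:P * (('X - m%:P) ^+ 4 + p%:P * ('X - m%:P) ^+ 2 + q%:P * ('X - m%:P))
  + d%:P.

Lemma map_centered_quartic (F G : fieldType) (h : {rmorphism F -> G})
    (a m p q d : F) :
  map_poly h (centered_quartic a m p q d) =
  centered_quartic (h a) (h m) (h p) (h q) (h d).
Proof.
rewrite /centered_quartic rmorphD rmorphM 2!rmorphD 2!rmorphM !rmorphXn /=.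
by rewrite rmorphB /= !map_polyC map_polyX.
Qed.

Lemma centered_quarticE (F : fieldType) (a m p q d : F) :
  centered_quartic a m p q d = Poly [:: a * (m ^+ 4 + p * m ^+ 2 - q * m) + d;
    a * (- 4 * m ^+ 3 - 2 * p * m + q); a * (6 * m ^+ 2 + p); - 4 * a * m; a].
Proof. rewrite /centered_quartic /= !cons_poly_def; ring. Qed.

Lemma size_centered_quartic (F : fieldType) (a m p q d : F) :
  a != 0 -> size (centered_quartic a m p q d) = 5%N.
Proof. by move=> a0; rewrite centered_quarticE (@PolyK _ 0). Qed.

(** Translating by the mean [m] of the roots removes the cubic term; this is where 4 must be
    invertible. *)
Lemma quartic_centered (F : fieldType) (f : {poly F}) :
  4 != 0 :> F -> size f = 5%N ->
  exists a m p q d, a != 0 /\ f = centered_quartic a m p q d.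
Proof.
move=> F4 sf; have a0 : f`_4 != 0.
  by have := lead_coef_eq0 f; rewrite lead_coefE -size_poly_eq0 sf => ->.
pose m := - f`_3 / (4 * f`_4).
pose p := f`_2 / f`_4 - 6 * m ^+ 2.
pose q := f`_1 / f`_4 + 4 * m ^+ 3 + 2 * p * m.
exists f`_4, m, p, q, (f`_0 - f`_4 * (m ^+ 4 + p * m ^+ 2 - q * m)).
split=> //; rewrite centered_quarticE.
apply/polyP=> i; rewrite coef_Poly.
case: i => [|[|[|[|[|i]]]]] /=.
- by ring.
- by rewrite /q; field.
- by rewrite /p; field.
- by rewrite /m; field; rewrite a0 F4.
- by [].
- by rewrite !nth_default // sf.
Qed.

(* c4 and c6 of the curve attached to the critical values of x^4 + p x^2 + q x. *)
Definition c4_quartic {F : fieldType} (p q : F) : F :=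
  p * (p ^+ 3 - 27 * q ^+ 2).

Definition c6_quartic {F : fieldType} (p q : F) : F :=
  p ^+ 6 + 135 / 2 * p ^+ 3 * q ^+ 2 - 729 / 8 * q ^+ 4.

Lemma c4_quartic_map (F G : fieldType) (h : {rmorphism F -> G}) p q :
  h (c4_quartic p q) = c4_quartic (h p) (h q).
Proof. by rewrite /c4_quartic; ring. Qed.

Lemma c6_quartic_map (F : fieldType) (G : numFieldType)
    (h : {rmorphism F -> G}) p q :
  h (c6_quartic p q) = c6_quartic (h p) (h q).
Proof. by rewrite /c6_quartic; field. Qed.

(** With [ti = m - zi] for the critical points [zi], the derivative gives e1 = 0, e2 = p/2, e3 = q/4
    for the elementary symmetric functions of the [ti]. Everything is then rational in [t1], [t2],
    and the claims become identities. *)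
Lemma critical_values_centered (a m p q d : algC) : a != 0 ->
  exists v1 v2 v3, let E := cubic_curve (cubic_of_roots v1 v2 v3) in
  [/\ critical_values (centered_quartic a m p q d) = [:: v1; v2; v3],
      a2 E = a * p ^+ 2 / 2 - 3 * d,
      c4 E = a ^+ 2 * c4_quartic p q &
      c6 E = a ^+ 3 * c6_quartic p q].
Proof.
move=> a0; set f := centered_quartic _ _ _ _ _.
have sf : size f = 5%N by apply: size_centered_quartic.
have f4 : f`_4 = a by rewrite /f centered_quarticE coef_Poly.
have a40 : a * 4 != 0 by rewrite mulf_neq0 ?pnatr_eq0.
have f'3 : f^`()`_3 = a * 4 by rewrite coef_deriv f4 mulr_natr.
have sf' : size f^`() = 4%N.
  apply/eqP; rewrite eqn_leq -ltnS -{1}sf lt_size_deriv //.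
    rewrite ltnNge; apply/negP => /leq_sizeP/(_ 3%N (leqnn _))/eqP.
    by rewrite f'3 (negPf a40).
  by rewrite -size_poly_gt0 sf.
rewrite /critical_values /roots_mult.
case: (closed_field_poly_normal _) => r def_f'; rewrite [sval _]/=.
have lcf' : lead_coef f^`() = a * 4 by rewrite lead_coefE sf'.
have : size r = 3%N.
  by have := sf'; rewrite def_f' lcf' size_scale // size_prod_XsubC => -[].
move: def_f'; rewrite lcf'.
case: r => [|z1 [|z2 [|z3 [|//]]]] // def_f' _.
have fE z : f.[z] = a * ((z - m) ^+ 4 + p * (z - m) ^+ 2 + q * (z - m)) + d.
  by rewrite /f /centered_quartic !hornerE.
have f'E t : 4 * ((t + m - z1) * ((t + m - z2) * (t + m - z3))) =
    4 * t ^+ 3 + 2 * p * t + q.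
  apply: (mulfI a0); transitivity f^`().[t + m].
    by rewrite def_f' !big_cons big_nil !hornerE /=; ring.
  rewrite /f /centered_quartic !(derivE, derivX, deriv_exp) !hornerE /=.
  by ring.
(* The second difference at 1, 0, -1 isolates the quadratic coefficient, which vanishes on the right
   of [f'E]. *)
have sum0 : (m - z1) + (m - z2) + (m - z3) = 0.
  have -> : (m - z1) + (m - z2) + (m - z3) =
    (4 * ((1 + m - z1) * ((1 + m - z2) * (1 + m - z3)))
    + 4 * ((-1 + m - z1) * ((-1 + m - z2) * (-1 + m - z3)))
    - 2 * (4 * ((0 + m - z1) * ((0 + m - z2) * (0 + m - z3))))) / 8 by field.
  by rewrite !f'E; field.
have q_eq : q = 4 * ((m - z1) * (m - z2) * (m - z3)).
  by transitivity (4 * 0 ^+ 3 + 2 * p * 0 + q); [ring | rewrite -f'E; ring].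
have p_eq : p =
    2 * ((m - z1) * (m - z2) + (m - z1) * (m - z3) + (m - z2) * (m - z3)).
  (* Evaluation at 1 yields the claim up to twice the sum in [sum0], which is added to the
     right-hand side as zero. *)
  transitivity ((4 * 1 ^+ 3 + 2 * p * 1 + q - 4 - q) / 2); first by field.
  rewrite -f'E q_eq -[RHS]addr0 -[X in _ = _ + X](mulr0 2) -sum0.
  by field.
have [t1 t1E] : exists t, t = m - z1 by exists (m - z1).
have [t2 t2E] : exists t, t = m - z2 by exists (m - z2).
have z1E : z1 = m - t1 by rewrite t1E; ring.
have z2E : z2 = m - t2 by rewrite t2E; ring.
have z3E : z3 = m + t1 + t2.
  by rewrite -[LHS]addr0 -sum0 t1E t2E; ring.
exists f.[z1], f.[z2], f.[z3].
rewrite cubic_curve_of_roots /c4 /c6 /b2 /b4 /b6 /= !fE.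
rewrite /c4_quartic /c6_quartic p_eq q_eq z1E z2E z3E.
by split=> //; field.
Qed.

(** * The parameter u and quadratic twists *)

Lemma j_invariant_quartic (F : numFieldType) (E : weierstrass F) (a p q : F) :
  discriminant E != 0 -> c4 E = a ^+ 2 * c4_quartic p q ->
  c6 E = a ^+ 3 * c6_quartic p q ->
  [/\ q != 0, 8 * p ^+ 3 + 27 * q ^+ 2 != 0 &
   let u := - 729 * q ^+ 2 / (8 * p ^+ 3 + 27 * q ^+ 2) in
   j_invariant E = (u + 3) ^+ 3 * (u + 27) / u].
Proof.
move=> D0 C4 C6; rewrite /j_invariant.
(* The last factor is, up to a constant, the discriminant of 4t^3 + 2pt + q, so it detects colliding
   critical points; [q = 0] makes the quartic even about its center, so opposite critical points
   share a value. *)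
have DE : discriminant E =
    - (a ^+ 6 * q ^+ 2 * (8 * p ^+ 3 + 27 * q ^+ 2) ^+ 3) / 4096.
  apply: (@mulfI _ 1728); first by rewrite pnatr_eq0.
  by rewrite discriminant_c4_c6 C4 C6 /c4_quartic /c6_quartic; field.
have a0 : a != 0 by apply: contraNneq D0 => a0; rewrite DE a0; apply/eqP; ring.
have q0 : q != 0 by apply: contraNneq D0 => q0; rewrite DE q0; apply/eqP; ring.
have w0 : 8 * p ^+ 3 + 27 * q ^+ 2 != 0.
  by apply: contraNneq D0 => w0; rewrite DE w0; apply/eqP; ring.
split=> //=; rewrite DE C4 /c4_quartic; field.
by rewrite a0 q0 w0.
Qed.

(** The formula for [s] inverts u = -729 / (8s + 27). Equal j-invariants give C^3 / D^2 = c^3 / e^2,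
    where c and e are the invariants for p = q = s; hence (D/e) / (C/c) is a twisting factor. *)
Lemma twist_parameter (F : numFieldType) (C D u s : F) :
  C != 0 -> D != 0 -> C ^+ 3 - D ^+ 2 != 0 -> u != 0 ->
  1728 * C ^+ 3 / (C ^+ 3 - D ^+ 2) = (u + 3) ^+ 3 * (u + 27) / u ->
  s = - 27 * (u + 27) / (8 * u) ->
  let a := D * c4_quartic s s / (c6_quartic s s * C) in
  [/\ a != 0, a ^+ 2 * c4_quartic s s = C & a ^+ 3 * c6_quartic s s = D].
Proof.
move=> C0 D0 CD0 u0 jE sE; pose N := (u + 3) ^+ 3 * (u + 27).
have relCD : 1728 * u * C ^+ 3 = N * (C ^+ 3 - D ^+ 2).
  transitivity (1728 * C ^+ 3 / (C ^+ 3 - D ^+ 2) * u * (C ^+ 3 - D ^+ 2)).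
    by field.
  by rewrite jE /N; field.
have N0 : N != 0.
  have: 1728 * u * C ^+ 3 != 0 by rewrite !mulf_neq0 ?expf_neq0 ?pnatr_eq0.
  by apply: contraNneq => N0; rewrite relCD N0 mul0r.
have [u3 u27] : u + 3 != 0 /\ u + 27 != 0.
  by move: N0; rewrite /N mulf_eq0 expf_eq0 /= negb_or => /andP.
set c := c4_quartic s s; set e := c6_quartic s s => a.
have c0 : c != 0.
  (* Here c = s^3 (s - 27), and s - 27 = -243 (u + 3) / (8u). *)
  have -> : c = 9 * 27 ^+ 4 * ((u + 27) ^+ 3 * (u + 3)) / (8 * u) ^+ 4.
    by rewrite /c /c4_quartic sE; field.
  by rewrite !mulf_neq0 ?invr_eq0 ?expf_neq0 ?mulf_neq0 ?pnatr_eq0.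
have rel : 1728 * u * c ^+ 3 = N * (c ^+ 3 - e ^+ 2).
  by rewrite /N /c /e /c4_quartic /c6_quartic sE; field.
(* Both pairs satisfy the same linear relation between cube and square, by [relCD] and [rel];
   eliminating u between them leaves a multiple of [N]. *)
have cross : C ^+ 3 * e ^+ 2 = c ^+ 3 * D ^+ 2.
  apply: (mulfI N0); transitivity
    (C ^+ 3 * (N * c ^+ 3) - C ^+ 3 * (N * (c ^+ 3 - e ^+ 2))); first by ring.
  rewrite -rel; transitivity
    (c ^+ 3 * (N * C ^+ 3) - c ^+ 3 * (1728 * u * C ^+ 3)); first by ring.
  by rewrite relCD; ring.
have e0 : e != 0.
  have : C ^+ 3 * e ^+ 2 != 0 by rewrite cross mulf_neq0 ?expf_neq0.
  by rewrite mulf_eq0 !expf_eq0 /= negb_or => /andP[].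
have CE : C ^+ 3 = c ^+ 3 * D ^+ 2 / e ^+ 2.
  by rewrite -cross mulfK ?expf_neq0.
split.
- by rewrite /a mulf_neq0 ?invr_eq0 ?(mulf_neq0 D0 c0) ?(mulf_neq0 e0 C0).
- transitivity (c ^+ 3 * D ^+ 2 / e ^+ 2 / C ^+ 2).
    by rewrite /a; field; rewrite C0 e0.
  by rewrite -CE; field.
- transitivity (c ^+ 3 * D ^+ 2 / e ^+ 2 * D / C ^+ 3).
    by rewrite /a; field; rewrite C0 e0.
  by rewrite -CE; field.
Qed.

(** Unique factorization turns equality of multisets into equality of cubics, where the invariants
    apply. *)
Lemma perm_eq_cubic_of_roots (v1 v2 v3 y1 y2 y3 : algC) :
  perm_eq [:: v1; v2; v3] [:: y1; y2; y3] =
  (cubic_of_roots v1 v2 v3 == cubic_of_roots y1 y2 y3).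
Proof.
have prodE z1 z2 z3 :
    \prod_(z <- [:: z1; z2; z3]) ('X - z%:P) = cubic_of_roots z1 z2 z3.
  by rewrite !big_cons big_nil mulr1 mulrA.
rewrite -!prodE; apply/idP/eqP; [exact: perm_big | exact: prod_XsubC_eq].
Qed.

(** * Descent to K and the equivalence *)

Theorem theorem1p2 (K : fieldExtType rat) (iota : {rmorphism K -> algC})
    (y1 y2 y3 : algC) (hy : uniq [:: y1; y2; y3])
    (hj0 : j_invariant (cubic_curve (cubic_of_roots y1 y2 y3)) <> 0)
    (hj1728 : j_invariant (cubic_curve (cubic_of_roots y1 y2 y3)) <> 1728) :
  (exists f : {poly K},
      size f = 5%N /\
      perm_eq (critical_values (map_poly iota f)) [:: y1; y2; y3])
  <->
  (defined_over iota (cubic_of_roots y1 y2 y3) /\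
   exists u : K, u <> 0 /\
     j_invariant (cubic_curve (cubic_of_roots y1 y2 y3)) =
       iota ((u + 3) ^+ 3 * (u + 27) / u)).
Proof.
have natK n : n.+1%:R != 0 :> K.
  by rewrite -(fmorph_eq0 iota) rmorph_nat pnatr_eq0.
have D0 := discriminant_neq0 _ _ _ hy.
split=> [[f [sf]]|[[g gE] [u [u0 jE]]]].
- have [a [m [p [q [d [a0 ->]]]]]] := quartic_centered _ _ (natK 3) sf.
  rewrite map_centered_quartic.
  have [|v1 [v2 [v3 [-> A C D]]]] :=
    critical_values_centered (iota a) (iota m) (iota p) (iota q) (iota d).
    by rewrite fmorph_eq0.
  rewrite perm_eq_cubic_of_roots => /eqP vE; rewrite vE in A C D.
  split.
    (* The three invariants are expressions in the coefficients of the quartic, hence lie in [K],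
       and so does the cubic rebuilt from them. *)
    exists (cubic_of_invariants (a * p ^+ 2 / 2 - 3 * d)
      (a ^+ 2 * c4_quartic p q) (a ^+ 3 * c6_quartic p q)).
    rewrite map_cubic_of_invariants cubic_of_rootsE A C D.
    congr cubic_of_invariants.
    - by field.
    - by rewrite rmorphM rmorphXn c4_quartic_map.
    - by rewrite rmorphM rmorphXn c6_quartic_map.
  have [q0 w0 ->] := j_invariant_quartic _ _ _ _ _ D0 C D.
  exists (- 729 * q ^+ 2 / (8 * p ^+ 3 + 27 * q ^+ 2)).
  have uE : iota (- 729 * q ^+ 2 / (8 * p ^+ 3 + 27 * q ^+ 2)) =
      - 729 * iota q ^+ 2 / (8 * iota p ^+ 3 + 27 * iota q ^+ 2).
    by rewrite fmorph_div; congr (_ / _); ring.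
  split; last by rewrite -uE [RHS]fmorph_div; congr (_ / _); ring.
  apply/eqP; rewrite -(fmorph_eq0 iota) uE.
  by rewrite !mulf_neq0 ?invr_eq0 ?oppr_eq0 ?pnatr_eq0 ?expf_neq0.
- set E := cubic_curve _ in D0 hj0 hj1728 jE.
  pose A := a2 (cubic_curve g).
  pose C := c4 (cubic_curve g); pose D := c6 (cubic_curve g).
  have AE : a2 E = iota A by rewrite /E -gE /= coef_map.
  have CE : c4 E = iota C by rewrite /E -gE c4_map.
  have DE : c6 E = iota D by rewrite /E -gE c6_map.
  have discE : discriminant E = (iota C ^+ 3 - iota D ^+ 2) / 1728.
    by rewrite -CE -DE -discriminant_c4_c6 mulrC mulKf ?pnatr_eq0.
  (* Excluding j = 0 and j = 1728 means that neither [c4] nor [c6] vanishes, as the twisting factor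
     requires. *)
  have C0 : iota C != 0.
    by apply/eqP => C0; apply: hj0; rewrite /j_invariant CE C0 expr0n mul0r.
  have D'0 : iota D != 0.
    by apply/eqP => D'0; apply: hj1728; rewrite j_invariant_eq1728 // DE.
  have iu0 : iota u != 0 by rewrite fmorph_eq0; apply/eqP.
  have CD0 : iota C ^+ 3 - iota D ^+ 2 != 0.
    by apply: contraNneq D0 => CD0; rewrite discE CD0 mul0r.
  pose s := - 27 * (u + 27) / (8 * u).
  pose a := D * c4_quartic s s / (c6_quartic s s * C).
  (* The lemma is applied in [algC], a [numFieldType]; [aE] then shows that the factor comes from
     [K]. *)
  have [||a0 aC aD] := twist_parameter _ _ _ _ (iota s) C0 D'0 CD0 iu0 _ _.
  - rewrite -CE -DE -discriminant_c4_c6 -mulf_div divff ?pnatr_eq0 // mul1r.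
    rewrite -/(j_invariant E) jE.
    by rewrite fmorph_div; congr (_ / _); ring.
  - by rewrite fmorph_div; congr (_ / _); ring.
  have aE : iota a = iota D * c4_quartic (iota s) (iota s) /
      (c6_quartic (iota s) (iota s) * iota C).
    rewrite fmorph_div (rmorphM iota D) (rmorphM iota _ C).
    by rewrite c4_quartic_map c6_quartic_map.
  rewrite -aE in a0 aC aD.
  (* This solves a s^2 / 2 - 3d = A, matching [a2] once [c4] and [c6] agree. *)
  pose d := (a * s ^+ 2 / 2 - A) / 3.
  exists (centered_quartic a 0 s s d); split.
    by rewrite size_centered_quartic // -(fmorph_eq0 iota).
  rewrite map_centered_quartic.
  have [v1 [v2 [v3 [-> vA vC vD]]]] :=
    critical_values_centered _ (iota 0) (iota s) (iota s) (iota d) a0.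
  rewrite perm_eq_cubic_of_roots (cubic_of_rootsE v1) (cubic_of_rootsE y1).
  rewrite vA vC vD -/E AE CE DE.
  rewrite aC aD; apply/eqP; congr cubic_of_invariants.
  by rewrite /d; field.
Qed.
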